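(* Let $E=([-1,1]\times\{0\})\cup(\{0\}\times[0,1])\subset\mathbb{R}^2$. Then \begin{itemize} \item $\mathcal{U}_{p}^{1}(E)<\infty$ for all $p\in(0,1)$, \item $\mathcal{I}_{p}^{1}(E)<\infty$ for all $p\in(0,2)$, \item $\mathcal{M}_{p}^{1}(E)<\infty$ for all $p\in(0,3)$. \end{itemize}
   Context: $\mathcal{H}^1$ is the one-dimensional Hausdorff measure. For mutually distinct points $x,y,z$ let $r(x,y,z)\in(0,\infty]$ be the circumradius of the triangle with these vertices ($r=\infty$ if the points are collinear). Conventions: $1/0=\infty$, $1/\infty=0$, $\inf\emptyset=\infty$. For a set $X$ put $\kappa(x,y,z)=1/r(x,y,z)$ if $x,y,z\in X$ are mutually distinct and $0$ otherwise; $\kappa_i(x,y)=1/\inf_{w\in X\setminus\{x,y\}} r(x,y,w)$ if $x\neq y$ and $\kappa_i(x,x)=0$; $\kappa_G(x)=1/\inf\{r(x,v,w): v,w\in X,\ x,v,w\text{ mutually distinct}\}$. For $p\in(0,\infty)$: $\mathcal{U}_p^{1}(X)=\int_X\kappa_G^p\,d\mathcal{H}^1$, $\mathcal{I}_p^{1}(X)=\int_X\int_X\kappa_i^p(x,y)\,d\mathcal{H}^1(x)d\mathcal{H}^1(y)$, $\mathcal{M}_p^{1}(X)=\int_X\int_X\int_X\kappa^p(x,y,z)\,d\mathcal{H}^1(x)d\mathcal{H}^1(y)d\mathcal{H}^1(z)$. *)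

(* Defs.v *)
From HB Require Import structures.
From mathcomp Require Import all_boot all_order all_algebra.
From mathcomp Require Import all_classical all_reals all_analysis.

Set Implicit Arguments.
Unset Strict Implicit.
Unset Printing Implicit Defensive.
Import Order.TTheory GRing.Theory Num.Theory.
Import numFieldNormedType.Exports.
Local Open Scope classical_set_scope.
Local Open Scope ring_scope.

(* The canonical distance of R * R is the sup distance, hence this definition. *)
Definition edist2 (R : realType) (x y : R * R) : R :=
  Num.sqrt ((x.1 - y.1) ^+ 2 + (x.2 - y.2) ^+ 2).

Section hausdorff_measure.
Local Open Scope ereal_scope.
Context {R : realType}.
Implicit Types (A B : set (R * R)) (F : (set (R * R))^nat) (delta : R).

(* The maximum with 0 is only there to give the empty set diameter 0. *)
Definition diam2 A : \bar R :=
  maxe 0 (ereal_sup [set (edist2 x y)%:E | x in A & y in A]).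

Definition delta_cover delta A F :=
  A `<=` \bigcup_k F k /\ forall k, diam2 (F k) <= delta%:E.

Definition hausdorff1_delta delta A : \bar R :=
  ereal_inf [set \sum_(k <oo) diam2 (F k) | F in delta_cover delta A].

(* In dimension 1 the usual normalising constant is 1. *)
Definition hausdorff1 A : \bar R :=
  ereal_sup [set hausdorff1_delta delta A | delta in [set d : R | (0 < d)%R]].

Lemma diam2_ge0 A : 0 <= diam2 A.
Proof. by rewrite /diam2 le_max lexx. Qed.

Lemma diam20 : diam2 set0 = 0.
Proof.
rewrite /diam2 (_ : [set _ | _ in _ & _ in _] = set0) ?ereal_sup0 ?maxeNy//.
by rewrite -subset0 => ? [].
Qed.

Lemma hausdorff1_delta_ge0 delta A : 0 <= hausdorff1_delta delta A.
Proof.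
apply: le_ereal_inf_tmp => _ [F _ <-].
by apply: nneseries_ge0 => n _ _; exact: diam2_ge0.
Qed.

Lemma hausdorff1_delta0 delta :
  (0 < delta)%R -> hausdorff1_delta delta set0 = 0.
Proof.
move=> d0; apply/eqP; rewrite eq_le hausdorff1_delta_ge0 andbT.
apply: ereal_inf_lbound; exists (fun=> set0).
  by split => // k; rewrite diam20 lee_fin ltW.
by apply: eseries0 => k _ _; rewrite diam20.
Qed.

Lemma le_hausdorff1_delta delta :
  {homo hausdorff1_delta delta : A B / A `<=` B >-> A <= B}.
Proof.
move=> A B AB; apply/ereal_inf_le_tmp => _ [F [BF dF] <-].
by exists F => //; split => //; exact: subset_trans AB BF.
Qed.

Lemma hausdorff1_delta_sigma_subadditive delta :
  sigma_subadditive (hausdorff1_delta delta).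
Proof.
move=> A; have [[i ioo]|] := pselect (exists i, hausdorff1_delta delta (A i) = +oo).
  rewrite (eseries_pinfty _ _ ioo) ?leey// => n _.
  by rewrite -ltNye (lt_le_trans _ (hausdorff1_delta_ge0 _ _)).
rewrite -forallNE => Aoo.
apply/lee_addgt0Pr => _ /posnumP[e].
rewrite (le_trans _ (epsilon_trick _ _ _))//; last first.
  by move=> n; exact: hausdorff1_delta_ge0.
pose P n F := delta_cover delta (A n) F /\
  \sum_(k <oo) diam2 (F k) <=
    hausdorff1_delta delta (A n) + (e%:num / (2 ^ n.+1)%:R)%:E.
have [G PG] : {G : ((set (R * R))^nat)^nat & forall n, P n (G n)}.
  apply: (@choice _ _ P) => n.
  have fA : hausdorff1_delta delta (A n) \is a fin_num.
    by rewrite ge0_fin_numE ?hausdorff1_delta_ge0// ltey; exact/eqP/Aoo.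
  have en1 : (0 < e%:num / (2 ^ n.+1)%:R)%R by [].
  have [_ [F cF <-] /ltW ?] := lb_ereal_inf_adherent en1 fA.
  by exists F.
have G0 x : 0 <= (diam2 \o uncurry G) x by exact: diam2_ge0.
apply: (@le_trans _ _ (\esum_(i in setT) (diam2 \o uncurry G) i)).
  apply: ereal_inf_lbound => /=.
  have /card_esym/ppcard_eqP[f] := card_nat2.
  exists (uncurry G \o f).
    split => [t [i _] Ait|k]; last first.
      by rewrite /= /uncurry; case: (f k) => i j; exact: (PG i).1.2.
    have [j _ Gij] := (PG i).1.1 _ Ait.
    by exists (f^-1%FUN (i, j)) => //=; rewrite invK ?inE.
  rewrite -(esum_pred_image (diam2 \o uncurry G) _ xpredT) ?[fun=> _]set_true//.
  by rewrite image_eq.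
rewrite (_ : esum _ _ = \sum_(i <oo) \sum_(j <oo) diam2 (G i j)).
  apply: lee_lim.
  - apply: is_cvg_nneseries => n *.
    by apply: nneseries_ge0 => m *; exact: (G0 (n, m)).
  - apply: is_cvg_nneseries => n *; apply: adde_ge0 => //.
    exact: hausdorff1_delta_ge0.
  - by near=> n; apply: lee_sum => i _; exact: (PG i).2.
pose J : nat -> set (nat * nat) := fun i => [set (i, j) | j in setT].
rewrite (_ : setT = \bigcup_k J k); last first.
  by rewrite predeqE => -[a b]; split => // _; exists a => //; exists b.
have tJ : trivIset setT J.
  apply/trivIsetP => i j _ _ ij.
  rewrite predeqE => -[n m] /=; split => //= -[] [_] _ [<-{n} _].
  by move=> [m' _] [] /esym/eqP; rewrite (negbTE ij).
rewrite esum_bigcupT //=.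
rewrite -(image_id [set: nat]) -fun_true esum_pred_image//; last first.
  by move=> n _; apply: esum_ge0 => *; exact: diam2_ge0.
apply: eq_eseriesr => /= j _.
rewrite -(esum_pred_image (diam2 \o uncurry G) (pair j) predT)//=; first last.
- by move=> ? ? _ _; exact: (@can_inj _ _ _ snd).
- by move=> ? _; exact: diam2_ge0.
by congr esum; rewrite predeqE => -[a b]; split; move=> [i _ <-]; exists i.
Unshelve. all: by end_near. Qed.

Lemma hausdorff1_0 : hausdorff1 set0 = 0.
Proof.
apply/eqP; rewrite eq_le; apply/andP; split.
  by apply: ge_ereal_sup => _ [d /= d0 <-]; rewrite hausdorff1_delta0.
by apply: ereal_sup_ubound; exists 1%R => //=; rewrite hausdorff1_delta0.
Qed.

Lemma hausdorff1_ge0 A : 0 <= hausdorff1 A.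
Proof.
apply: (@le_trans _ _ (hausdorff1_delta 1 A)); first exact: hausdorff1_delta_ge0.
by apply: ereal_sup_ubound; exists 1%R => /=.
Qed.

Lemma le_hausdorff1 : {homo hausdorff1 : A B / A `<=` B >-> A <= B}.
Proof.
move=> A B AB; apply: ge_ereal_sup => _ [d d0 <-].
apply: (@le_trans _ _ (hausdorff1_delta d B)); first exact: le_hausdorff1_delta.
by apply: ereal_sup_ubound; exists d.
Qed.

Lemma hausdorff1_sigma_subadditive : sigma_subadditive hausdorff1.
Proof.
move=> A; apply: ge_ereal_sup => _ [d d0 <-].
apply: (le_trans (hausdorff1_delta_sigma_subadditive d A)).
apply: lee_nneseries => [n _ _|n _]; first exact: hausdorff1_delta_ge0.
by apply: ereal_sup_ubound; exists d.
Qed.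

HB.instance Definition _ := isOuterMeasure.Build R (R * R)%type hausdorff1
  hausdorff1_0 hausdorff1_ge0 le_hausdorff1 hausdorff1_sigma_subadditive.

End hausdorff_measure.

(* H^1 as a measure on the sigma-algebra of its Caratheodory-measurable sets. *)
Definition hausdorff1_outer (R : realType) :
  {outer_measure set (R * R) -> \bar R} := @hausdorff1 R.

Notation plane R := (caratheodory_type (hausdorff1_outer R)).

Definition hausdorff1_measure (R : realType) :
  {measure set (plane R) -> \bar R} :=
  hausdorff1_outer R : set (plane R) -> \bar R.

Section curvature_energies.
Local Open Scope ereal_scope.
Context {R : realType}.
Implicit Types (X : set (R * R)) (x y z : R * R) (p : R).

(* Radius of the circle through x, y, z: that circle is unique if the points
   are not collinear, and there is none, so that the value is +oo, if they are
   distinct and collinear. *)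
Definition circumradius x y z : \bar R :=
  ereal_inf [set rho%:E | rho in
    [set rho : R | exists c : R * R,
       [/\ edist2 c x = rho, edist2 c y = rho & edist2 c z = rho]]].

Definition mutually_distinct x y z : Prop := [/\ x <> y, y <> z & x <> z].

Definition kappa X x y z : \bar R :=
  if `[< [/\ X x, X y, X z & mutually_distinct x y z] >]
  then (circumradius x y z)^-1 else 0.

Definition kappa_i X x y : \bar R :=
  if x == y then 0
  else (ereal_inf [set circumradius x y w | w in X `\` [set x; y]])^-1.

Definition kappa_G X x : \bar R :=
  (ereal_inf [set circumradius x vw.1 vw.2 | vw in
    [set vw : (R * R) * (R * R) |
       [/\ X vw.1, X vw.2 & mutually_distinct x vw.1 vw.2]]])^-1.

Definition U_energy p X : \bar R :=
  \int[hausdorff1_measure R]_(x in X) kappa_G X x `^ p.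

Definition I_energy p X : \bar R :=
  \int[hausdorff1_measure R]_(y in X)
    \int[hausdorff1_measure R]_(x in X) kappa_i X x y `^ p.

Definition M_energy p X : \bar R :=
  \int[hausdorff1_measure R]_(z in X)
    \int[hausdorff1_measure R]_(y in X)
      \int[hausdorff1_measure R]_(x in X) kappa X x y z `^ p.

End curvature_energies.

Definition E_set (R : realType) : set (R * R) :=
  (`[-1, 1] `*` [set 0]) `|` ([set 0] `*` `[0, 1]).
Arguments E_set R _ : clear implicits.

(* Main.v *)
(* If three distinct points of E lie on a circle of radius rho, they are not on
   one segment, so each of them is at distance at least its norm from one of the
   other two; hence its norm is at most 2 rho. So kappa(x, y, z) is at most
   2 / |w| for each w among x, y, z, and
     kappa^p <= (2 / |x|)^(p/3) (2 / |y|)^(p/3) (2 / |z|)^(p/3);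
   likewise kappa_i^p is bounded by a product of two factors of exponent p/2 and
   kappa_G^p by one factor of exponent p. All three claims thus reduce to the
   finiteness of the integral of |x|^(-s) over E for s < 1, which holds because
   the part of E in the ball of radius t has H^1 measure at most 3 t. *)
Require Import Defs.
From mathcomp Require Import all_boot all_order all_algebra.
From mathcomp Require Import all_classical all_reals all_analysis.
From mathcomp Require Import measurable_realfun ring lra.

Set Implicit Arguments.
Unset Strict Implicit.
Unset Printing Implicit Defensive.
Import Order.TTheory GRing.Theory Num.Theory.
Import numFieldNormedType.Exports HBNNSimple.
Local Open Scope classical_set_scope.
Local Open Scope ring_scope.

(* The layer cake bound for the supremum over simple functions below [f]: since
   only the level sets of these simple functions enter, neither [f] nor [D] has
   to be measurable. *)
Lemma ge0_integral_le_layers d (T : measurableType d) (R : realType)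
    (mu : {measure set T -> \bar R}) (D : set T) (f : T -> \bar R)
    (c : nat -> R) (m : nat -> \bar R) :
  (forall x, D x -> (0 <= f x)%E) ->
  c 0%N = 0 -> (forall n, 0 <= c n) -> (forall x, exists n, x <= c n) ->
  (forall n B, measurable B -> B `<=` D ->
    (forall x, B x -> ((c n)%:E < f x)%E) -> (mu B <= m n)%E) ->
  (\int[mu]_(x in D) f x <= \sum_(n <oo) (c n.+1)%:E * m n)%E.
Proof.
move=> f0 c00 c0 c_unbounded mu_le; rewrite ge0_integralE//.
apply: ge_ereal_sup => _ [h hf <-]; rewrite -integralT_nnsfun.
pose B n := h @^-1` `]c n, +oo[.
have mB n : measurable (B n) by exact: measurable_funPTI.
pose g n x : \bar R := ((c n.+1)%:E * (\1_(B n) x)%:E)%E.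
have g0 n x : (0 <= g n x)%E.
  by rewrite /g -EFinM lee_fin mulr_ge0// indicE.
have mg n : measurable_fun [set: T] (g n).
  by apply: measurable_funeM; apply/measurable_EFinP; exact: measurable_indic.
apply: (@le_trans _ _ (\int[mu]_x (\sum_(n <oo) g n x))%E).
  apply: ge0_le_integral => //.
  - by move=> x _; rewrite lee_fin.
  - by apply/measurable_EFinP; exact: measurable_funPT.
  - exact: ge0_emeasurable_sum.
  move=> x _; have [/eqP hx0|hx0] := boolP (h x == 0).
    by rewrite hx0; apply: nneseries_ge0.
  (* The least [n] with [h x <= c n] is not 0, since [c 0 = 0 < h x]; its predecessor [k] satisfies
     [c k < h x <= c k.+1], so the term [k] alone dominates [h x]. *)
  case: (ex_minnP (c_unbounded (h x))) => -[|k] hck ck_min.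
    move: hck; rewrite c00 real_leNgt ?num_real//.
    by rewrite lt_neqAle eq_sym hx0 fun_ge0.
  have hk : c k < h x by rewrite ltNge; apply/negP => /ck_min; rewrite ltnn.
  apply: le_trans (nneseries_lim_ge k.+1 (fun n _ _ => g0 n x)).
  have Bkx : B k x by rewrite /B/= in_itv/= andbT.
  rewrite big_nat_recr//= {2}/g indicE mem_set// mule1.
  apply: (@le_trans _ _ (c k.+1)%:E); first by rewrite lee_fin.
  by apply: leeDr; apply: sume_ge0 => n _; exact: (g0 n x).
rewrite integral_nneseries//; apply: lee_nneseries => [n _ _|n _].
  exact: integral_ge0.
have -> : (\int[mu]_x g n x = (c n.+1)%:E * mu (B n))%E.
  rewrite /g ge0_integralZl_EFin ?integral_indic ?setIT//.
  by apply/measurable_EFinP; exact: measurable_indic.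
rewrite lee_wpmul2l ?lee_fin//.
(* [h] lies below the extension of [f] by 0, hence is at most 0 off [D], whereas [h > c n >= 0] on
   [B n]. *)
have BD x : B n x -> D x.
  rewrite /B /= in_itv/= andbT => cnh; apply: contrapT => nDx.
  have := hf x; rewrite patchE memNset// lee_fin => h0.
  by have := le_lt_trans (c0 n) (lt_le_trans cnh h0); rewrite ltxx.
apply: mu_le => // x Bx; have Dx := BD x Bx.
have := hf x; rewrite patchE mem_set//; apply: lt_le_trans.
by move: Bx; rewrite /B /= in_itv/= andbT lte_fin.
Qed.

(** * Hausdorff measure of the cross near the origin *)

Lemma diam2_le (R : realType) (A : set (R * R)) (r : R) :
  0 <= r -> (forall x y, A x -> A y -> edist2 x y <= r) -> (diam2 A <= r%:E)%E.
Proof.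
move=> r0 Ar; rewrite /diam2 ge_max lee_fin r0/=.
by apply: ge_ereal_sup => _ [x Ax [y Ay <-]]; rewrite lee_fin Ar.
Qed.

(** Cutting the interval into [N] pieces of equal length [s <= d] gives a cover by sets of diameter
    at most [s], of total at most [N * s = t] for every [d]. *)
Lemma hausdorff1_lipschitz_le (R : realType) (f : R -> R * R) (t : R) :
  0 <= t -> (forall a b, edist2 (f a) (f b) <= `|a - b|) ->
  (hausdorff1 (f @` `[0%R, t]) <= t%:E)%E.
Proof.
move=> t0 f_lip; apply: ge_ereal_sup => _ [d /= d0 <-].
pose N := (Num.trunc (t / d)).+1.
pose s := t / N%:R.
have N0 : (0 : R) < N%:R by rewrite ltr0n.
have s0 : 0 <= s by rewrite divr_ge0.
have sd : s <= d.
  by rewrite ler_pdivrMr// mulrC -ler_pdivrMr// ltW// truncnS_gt.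
have NsE : N%:R * s = t by rewrite mulrC divfK// gt_eqF.
pose F k := if (k < N)%N then f @` `[k%:R * s, k.+1%:R * s] else set0.
have diamF k : (diam2 (F k) <= (if (k < N)%N then s else 0)%:E)%E.
  rewrite /F; case: ifPn => _; last by rewrite diam20.
  apply: diam2_le => // _ _ [a + <-] [b + <-].
  rewrite /= !in_itv/= -natr1 mulrDl mul1r => /andP[a1 a2] /andP[b1 b2].
  by apply: le_trans (f_lip a b) _; rewrite ler_norml; lra.
apply: (@le_trans _ _ (\sum_(k <oo) diam2 (F k))%E).
  apply: ereal_inf_lbound; exists F => //; split; last first.
    move=> k; apply: le_trans (diamF k) _; rewrite lee_fin.
    by case: ifP => // _; exact: ltW.
  move=> _ [a + <-]; rewrite /= in_itv/= => /andP[a0 at_].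
  (* The least such [k] also satisfies [k * s <= a], which places [a] in the piece [k]. *)
  have ex_k : exists k, a <= k.+1%:R * s.
    by exists (Num.trunc (t / d)); rewrite NsE.
  case: (ex_minnP ex_k) => k ak k_min; exists k => //.
  have kN : (k < N)%N by rewrite ltnS k_min// NsE.
  rewrite /F kN; exists a => //=; rewrite in_itv/= ak andbT.
  case: k ak k_min kN => [|k] ak k_min kN; first by rewrite mul0r.
  by rewrite leNgt; apply/negP => /ltW/k_min; rewrite ltnn.
rewrite (nneseries_split _ N)/=; last by move=> k _; exact: diam2_ge0.
rewrite add0n [X in (_ + X)%E]eseries0 ?adde0; last first.
  by move=> k Nk _; rewrite /F ltnNge Nk diam20.
have -> : t%:E = (\sum_(0 <= k < N) s%:E)%E.
  by rewrite sumEFin sumr_const_nat subn0 -mulr_natl NsE.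
rewrite big_nat [leRHS]big_nat; apply: lee_sum => k /andP[_ kN].
by have := diamF k; rewrite kN.
Qed.

(* On the cross, where one coordinate vanishes, this is the Euclidean norm. *)
Definition norm1 (R : realType) (x : R * R) : R := `|x.1| + `|x.2|.

Lemma norm1_ge0 (R : realType) (x : R * R) : 0 <= norm1 x.
Proof. by rewrite addr_ge0. Qed.

Lemma edist2_le (R : realType) (x y : R * R) (r : R) : 0 <= r ->
  (x.1 - y.1) ^+ 2 + (x.2 - y.2) ^+ 2 <= r ^+ 2 -> edist2 x y <= r.
Proof.
move=> r0 xyr; rewrite -(ger0_norm r0) -sqrtr_sqr.
exact: ler_wsqrtr.
Qed.

(** Three arms of length [t], each a 1-Lipschitz image of an interval, cover the set. *)
Lemma hausdorff1_cross_le (R : realType) (t : R) : 0 <= t ->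
  (hausdorff1 (E_set R `&` [set x | (norm1 x <= t)%R]) <= (3 * t)%:E)%E.
Proof.
move=> t0.
pose f1 (a : R) : R * R := (a, 0); pose f2 (a : R) : R * R := (- a, 0).
pose f3 (a : R) : R * R := (0, a).
have -> : (3 * t)%:E = (t%:E + t%:E + t%:E)%E.
  by rewrite -!EFinD; congr (_%:E); ring.
apply: (@le_trans _ _ (hausdorff1_outer R
    ((f1 @` `[0, t] `|` f2 @` `[0, t]) `|` f3 @` `[0, t]))).
  apply: le_hausdorff1 => -[a b] [+ /=]; rewrite /norm1/=.
  move=> [[_ /= ->]|[/= -> + ]]; rewrite normr0 ?addr0 ?add0r.
    move=> at_; left; have [a0|/ltW a0] := leP 0 a.
      by left; exists a; rewrite //= in_itv/= a0 -(ger0_norm a0).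
    right; exists (- a); rewrite /f2 ?opprK//= in_itv/= oppr_ge0 a0.
    by rewrite -(ler0_norm a0).
  rewrite /= in_itv/= => /andP[b0 _] bt.
  by right; exists b; rewrite //= in_itv/= b0 -(ger0_norm b0).
apply: le_trans (outer_measureU2 _ _ _) _; apply: leeD.
  apply: le_trans (outer_measureU2 _ _ _) _; apply: leeD;
  apply: hausdorff1_lipschitz_le => // a b; apply: edist2_le => //=;
  rewrite -normrX ger0_norm ?sqr_ge0//; nra.
apply: hausdorff1_lipschitz_le => // a b; apply: edist2_le => //=.
by rewrite -normrX ger0_norm ?sqr_ge0//; nra.
Qed.

(** * Circles through three points of the cross *)

(* A circle meets a line in at most two points, so some [w] among [y], [z] lies
   on the other segment of the cross; then [norm1 x] is at most the distance
   from [x] to [w], which is at most the diameter. *)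
Lemma norm1_le_diameter (R : realType) (x y z c : R * R) (rho : R) :
  E_set R x -> E_set R y -> E_set R z -> mutually_distinct x y z ->
  edist2 c x = rho -> edist2 c y = rho -> edist2 c z = rho ->
  norm1 x <= 2 * rho.
Proof.
have edist2_sqr (u v : R * R) r : edist2 u v = r ->
    0 <= r /\ (u.1 - v.1) ^+ 2 + (u.2 - v.2) ^+ 2 = r ^+ 2.
  by move=> <-; rewrite sqr_sqrtr ?addr_ge0 ?sqr_ge0//; split => //;
    exact: sqrtr_ge0.
(* For a circle with centre [(e, f)] through [(a, 0)] and [(0, b)], [a^2 + (2e - a)^2 = 2(e - a)^2 +
   2e^2 <= 4r^2]. *)
have cross (a b e f r : R) : 0 <= r -> (e - a) ^+ 2 + f ^+ 2 = r ^+ 2 ->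
    e ^+ 2 + (f - b) ^+ 2 = r ^+ 2 -> `|a| <= 2 * r.
  move=> r0 ea eb; rewrite -(@ler_pXn2r _ 2) ?nnegrE ?mulr_ge0//.
  rewrite real_normK ?num_real//.
  by have := (sqr_ge0 (2 * e - a), sqr_ge0 f, sqr_ge0 (f - b)) => -[[]]; nra.
case: x y z c => [x1 x2] [y1 y2] [z1 z2] [c1 c2].
move=> Ex Ey Ez [xy yz xz] /edist2_sqr[r0 /= cx] /edist2_sqr[_ /= cy].
move=> /edist2_sqr[_ /= cz]; rewrite /norm1/=.
(* Subtracting the equations pairwise gives [a + b = 2 * e = b + d], so [a = d]. *)
have line (a b d e f r : R) : a <> b -> b <> d -> a <> d ->
    (e - a) ^+ 2 + f = r -> (e - b) ^+ 2 + f = r ->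
    (e - d) ^+ 2 + f = r -> False.
  move=> /eqP; rewrite -subr_eq0 => ab /eqP; rewrite -subr_eq0 => bd.
  move=> /eqP; rewrite -subr_eq0 => ad ea eb ed; apply/negP: ad.
  apply/negPn/eqP; apply: (mulfI ab); apply: (mulfI bd).
  have h1 : (a - b) * (a + b - 2 * e) = 0 by lra.
  have h2 : (b - d) * (b + d - 2 * e) = 0 by lra.
  move/eqP : h1; rewrite mulf_eq0 (negbTE ab)/= => /eqP h1.
  move/eqP : h2; rewrite mulf_eq0 (negbTE bd)/= => /eqP h2.
  by have -> : a - d = 0 by lra.
have pairP (u1 u2 v1 v2 : R) : (u1, u2) <> (v1, v2) -> u1 = v1 -> u2 <> v2.
  by move=> + uv1 uv2; rewrite uv1 uv2.
have pairP' (u1 u2 v1 v2 : R) : (u1, u2) <> (v1, v2) -> u2 = v2 -> u1 <> v1.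
  by move=> + uv1 uv2; rewrite uv1 uv2.
(* Only the first and the last of the eight cases put all three points on one segment. When [x] is
   on the vertical segment, [addrC] swaps the coordinates. *)
case: Ex => [[/= _ x0]|[/= x0 _]]; case: Ey => [[/= _ y0]|[/= y0 _]];
  case: Ez => [[/= _ z0]|[/= z0 _]]; subst;
  rewrite ?subr0 in cx cy cz; rewrite ?normr0 ?addr0 ?add0r.
- by exfalso; apply: (line x1 y1 z1 c1 (c2 ^+ 2) _ _ _ _ cx cy cz);
    [apply: pairP' xy _|apply: pairP' yz _|apply: pairP' xz _].
- exact: (cross _ z2 c1 c2).
- exact: (cross _ y2 c1 c2).
- exact: (cross _ y2 c1 c2).
- by rewrite addrC in cx; rewrite addrC in cy; exact: (cross _ y1 c2 c1).
- by rewrite addrC in cx; rewrite addrC in cy; exact: (cross _ y1 c2 c1).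
- by rewrite addrC in cx; rewrite addrC in cz; exact: (cross _ z1 c2 c1).
exfalso; rewrite addrC in cx; rewrite addrC in cy; rewrite addrC in cz.
by apply: (line x2 y2 z2 c2 (c1 ^+ 2) _ _ _ _ cx cy cz);
  [apply: pairP xy _|apply: pairP yz _|apply: pairP xz _].
Qed.

(** * Integrals over the cross against a weight *)

Lemma exprn_powR (R : realType) (a s : R) (n : nat) : 0 <= a ->
  (a `^ s) ^+ n = (a ^+ n) `^ s.
Proof.
by move=> a0; rewrite -!powR_mulrn ?powR_ge0// -!powRrM mulrC.
Qed.

(* This is [(2 / norm1 x) ^ s], with value [+oo] at the origin when [0 < s]. *)
Definition weight (R : realType) (s : R) (x : R * R) : \bar R :=
  (((norm1 x / 2)%:E)^-1 `^ s)%E.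

Lemma weight_ge0 (R : realType) (s : R) (x : R * R) : (0 <= weight s x)%E.
Proof. exact: poweR_ge0. Qed.

(** By contraposition, which avoids the origin: if [norm1 x > 2 * 2^-1 ^+ n], the inverse in
    [weight] is real and at most [2 ^+ n]. *)
Lemma weight_gt_norm1_le (R : realType) (s : R) (x : R * R) (n : nat) :
  0 < s -> (((2 `^ s) ^+ n)%:E < weight s x)%E -> norm1 x <= 2 * 2^-1 ^+ n.
Proof.
move=> s0; rewrite leNgt; apply: contraTN => nx.
have pow0 : (0 : R) < 2^-1 ^+ n by rewrite exprn_gt0// invr_gt0.
have x0 : 0 < norm1 x / 2.
  by rewrite divr_gt0// (lt_trans _ nx)// mulr_gt0.
rewrite -leNgt /weight inver gt_eqF// poweR_EFin lee_fin.
rewrite exprn_powR//.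
rewrite ge0_ler_powR ?nnegrE ?invr_ge0 ?exprn_ge0//; do ?exact: ltW.
by rewrite -[leRHS]invrK -exprVn lef_pV2 ?posrE//; lra.
Qed.

Lemma cross_integral_le (R : realType) (s : R) : 0 < s < 1 ->
  exists2 K : R, 0 < K & forall (C : \bar R) (f : R * R -> \bar R),
    (0 <= C)%E ->
    (forall x, E_set R x -> (0 <= f x)%E /\ (f x <= C * weight s x)%E) ->
    (\int[hausdorff1_measure R]_(x in E_set R) f x <= K%:E * C)%E.
Proof.
move=> /andP[s0 s1]; pose b : R := 2 `^ s.
have pow2_gt1 (r : R) : 0 < r -> 1 < 2 `^ r.
  move=> r0; have := @gt0_ltr_powR R r r0 1 2.
  by rewrite !nnegrE powR1 ltr1n; exact.
have b1 : 1 < b by exact: pow2_gt1.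
have b2 : b < 2.
  have <- : b * 2 `^ (1 - s) = 2.
    by rewrite /b -powRD ?subrKC ?powRr1// pnatr_eq0 implybT.
  by rewrite ltr_pMr; [apply: pow2_gt1; lra|lra].
have b0 : 0 < b by lra.
have q0 : 0 < b / 2 by lra.
have q1 : `|b / 2| < 1 by rewrite gtr0_norm//; lra.
(* This is the sum over [n] of [b ^+ n.+1 * (3 * (2 * 2^-1 ^+ n))]. *)
exists (6 * b / (1 - b / 2)); first by apply: divr_gt0; lra.
move=> [r| |//] f; last first.
  by move=> _ _; rewrite gt0_muley ?leey// lte_fin; apply: divr_gt0; lra.
(* The levels below are multiples of [r], so [r = 0] is treated apart; there [0 * weight s x = 0]
   even at the origin. *)
rewrite lee_fin le_eqVlt => /predU1P[<- fw|r0 fw].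
  rewrite mule0 integral0_eq// => x Ex; have [f0 fx] := fw x Ex.
  by apply/eqP; rewrite eq_le f0 andbT (le_trans fx)// mul0e.
(* Level 0 is lowered from [r] to 0. Its layer may then be the whole cross, which still lies in the
   ball of radius [2 * 2^-1 ^+ 0 = 2]. *)
pose c n : R := if n is 0%N then 0 else r * b ^+ n.
pose m n : \bar R := (3 * (2 * 2^-1 ^+ n))%:E.
have c0 n : 0 <= c n.
  by case: n => //= n; rewrite mulr_ge0 ?exprn_ge0 ?ltW.
apply: (@le_trans _ _ (\sum_(n <oo) (c n.+1)%:E * m n)%E); last first.
  apply: lime_le.
    apply: is_cvg_nneseries => n _ _; rewrite /m -EFinM lee_fin.
    by apply: mulr_ge0 => //;
      rewrite mulr_ge0// mulr_ge0// exprn_ge0// invr_ge0.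
  apply: nearW => n; have := @geometric_le_lim R n (6 * b * r) (b / 2).
  move=> /(_ _ q0 q1) h; rewrite -EFinM.
  rewrite (eq_bigr (fun k => (geometric (6 * b * r) (b / 2) k)%:E)); last first.
    move=> k _; rewrite /m /c -EFinM /geometric/= exprMn exprS.
    by congr EFin; ring.
  rewrite sumEFin lee_fin [leRHS]mulrAC; apply: h.
  by rewrite ltW// !mulr_gt0.
apply: ge0_integral_le_layers => //.
- by move=> x /fw[].
- move=> y; have [y0|/ltW y0] := leP y 0; first by exists 0%N.
  (* Chosen so that [z <= 2 ^+ n] amounts to [y / r <= b ^+ n]. *)
  pose z := (y / r) `^ s^-1.
  exists (Num.bound z).+1; rewrite /c -ler_pdivrMl// mulrC.
  have : z < 2 ^+ (Num.bound z).+1 by apply: upper_nthrootP.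
  move=> /ltW zn; have yr : 0 <= y / r by rewrite divr_ge0// ltW.
  have := @ge0_ler_powR _ s (ltW s0) z (2 ^+ (Num.bound z).+1).
  rewrite !nnegrE powR_ge0 exprn_ge0// => /(_ isT isT zn).
  rewrite /z -powRrM mulVf ?gt_eqF// powRr1//.
  by rewrite -exprn_powR.
move=> n B _ BE Bf; apply: (@le_trans _ _ (hausdorff1
    (E_set R `&` [set x | norm1 x <= 2 * 2^-1 ^+ n]))); last first.
  by apply: hausdorff1_cross_le; apply: mulr_ge0 => //; apply: exprn_ge0;
    rewrite invr_ge0.
apply: le_hausdorff1 => x Bx; have Ex := BE x Bx; split => //=.
case: n Bf => [|n] /(_ x Bx) fx.
  rewrite expr0 mulr1; case: x Ex {Bx fx} => a e; rewrite /norm1.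
  by move=> [[/= + ->]|[/= -> +]]; rewrite /= in_itv/= normr0 => /andP[? ?];
    rewrite ?addr0 ?add0r ler_norml; lra.
apply: (@weight_gt_norm1_le _ s) => //.
rewrite -(@lte_pmul2l _ r%:E) ?lte_fin//.
by apply: lt_le_trans (fw x Ex).2; rewrite -EFinM.
Qed.

(** * Curvature bounds and energies *)

Lemma circumradius_ge_norm1 (R : realType) (x y z : R * R) :
  E_set R x -> E_set R y -> E_set R z -> mutually_distinct x y z ->
  [/\ ((norm1 x / 2)%:E <= circumradius x y z)%E,
      ((norm1 y / 2)%:E <= circumradius x y z)%E
    & ((norm1 z / 2)%:E <= circumradius x y z)%E].
Proof.
move=> Ex Ey Ez xyz; have [xy yz xz] := xyz.
have yzx : mutually_distinct y z x by split => //; exact: nesym.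
have zxy : mutually_distinct z x y by split => //; exact: nesym.
split; apply: le_ereal_inf_tmp => _ [rho [c [cx cy cz]] <-];
  rewrite lee_fin ler_pdivrMr// mulrC.
- exact: norm1_le_diameter Ex Ey Ez xyz cx cy cz.
- exact: norm1_le_diameter Ey Ez Ex yzx cy cz cx.
- exact: norm1_le_diameter Ez Ex Ey zxy cz cx cy.
Qed.

Lemma poweR_inve_le_weight (R : realType) (s : R) (r : \bar R) (x : R * R) :
  0 <= s -> ((norm1 x / 2)%:E <= r)%E -> (r^-1 `^ s <= weight s x)%E.
Proof.
move=> s0 xr; have x0 : (0 <= (norm1 x / 2)%:E)%E.
  by rewrite lee_fin divr_ge0// norm1_ge0.
have r0 := le_trans x0 xr.
apply: gt0_ler_poweR => //; rewrite ?in_itv/= ?leey ?inve_ge0 ?x0 ?r0//.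
by rewrite lee_pV2 ?inE.
Qed.

Lemma kappa_G_le (R : realType) (p : R) (x : R * R) : 0 <= p -> E_set R x ->
  (kappa_G (E_set R) x `^ p <= weight p x)%E.
Proof.
move=> p0 Ex; apply: poweR_inve_le_weight => //.
apply: le_ereal_inf_tmp => _ [[v w] [Ev Ew xvw] <-].
by have [] := circumradius_ge_norm1 Ex Ev Ew xvw.
Qed.

(** The factor in [y] comes first, to serve as the constant in the integral over [x]. *)
Lemma kappa_i_le (R : realType) (p : R) (x y : R * R) : 0 < p ->
  E_set R x -> E_set R y ->
  (kappa_i (E_set R) x y `^ p <= weight (p / 2) y * weight (p / 2) x)%E.
Proof.
move=> p0 Ex Ey; rewrite /kappa_i; case: eqVneq => [_|/eqP xy].
  by rewrite poweR0r ?gt_eqF// mule_ge0 ?weight_ge0.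
rewrite [in leLHS](splitr p) poweRD; last first.
  by rewrite add_neq0_poweRD_def// -splitr gt_eqF.
have E_distinct w : (E_set R `\` [set x; y]) w ->
    E_set R w /\ mutually_distinct x y w.
  move=> [Ew /not_orP[wx wy]]; split => //; split => //; exact: nesym.
have p2 : 0 <= p / 2 by rewrite divr_ge0// ltW.
apply: lee_pmul; rewrite ?poweR_ge0//; apply: poweR_inve_le_weight => //;
  apply: le_ereal_inf_tmp => _ [w /E_distinct[Ew xyw] <-];
  by have [] := circumradius_ge_norm1 Ex Ey Ew xyw.
Qed.

Lemma kappa_le (R : realType) (p : R) (x y z : R * R) : 0 < p ->
  (kappa (E_set R) x y z `^ p <=
   weight (p / 3) z * weight (p / 3) y * weight (p / 3) x)%E.
Proof.
move=> p0; rewrite /kappa; case: asboolP => [[Ex Ey Ez xyz]|_]; last first.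
  by rewrite poweR0r ?gt_eqF// !mule_ge0 ?weight_ge0.
have p3 : 0 < p / 3 by rewrite divr_gt0.
have pE : p = p / 3 + p / 3 + p / 3 by field.
rewrite [in leLHS]pE !poweRD; last 2 first.
- by rewrite add_neq0_poweRD_def// gt_eqF// addr_gt0.
- by rewrite add_neq0_poweRD_def// gt_eqF// !addr_gt0.
have [xr yr zr] := circumradius_ge_norm1 Ex Ey Ez xyz.
by do !apply: lee_pmul; rewrite ?mule_ge0 ?poweR_ge0//;
  apply: poweR_inve_le_weight => //; exact: ltW.
Qed.

Theorem proposition1p2 (R : realType) :
  [/\ forall p : R, (0 < p < 1)%R -> (U_energy p (E_set R) < +oo)%E,
      forall p : R, (0 < p < 2)%R -> (I_energy p (E_set R) < +oo)%E
    & forall p : R, (0 < p < 3)%R -> (M_energy p (E_set R) < +oo)%E].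
Proof.
split=> p /andP[p0 p_lt].
- have [|K K0 int_le] := @cross_integral_le R p; first by rewrite p0.
  apply: (@le_lt_trans _ _ (K%:E * 1)%E); last by rewrite mule1 ltry.
  apply: (int_le) => // x Ex.
  by rewrite poweR_ge0 mul1e kappa_G_le// ltW.
- have [|K K0 int_le] := @cross_integral_le R (p / 2); first by lra.
  have K0' : (0 <= K%:E)%E by rewrite lee_fin ltW.
  apply: (@le_lt_trans _ _ (K%:E * K%:E)%E); last by rewrite -EFinM ltry.
  (* The outer integral is bounded with [C = K], the inner one with [C = weight (p / 2) y]. *)
  apply: (int_le) => // y Ey; split.
    by apply: integral_ge0 => x _; exact: poweR_ge0.
  apply: (int_le) => [|x Ex]; first exact: weight_ge0.
  by rewrite poweR_ge0 kappa_i_le.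
- have [|K K0 int_le] := @cross_integral_le R (p / 3); first by lra.
  have K0' : (0 <= K%:E)%E by rewrite lee_fin ltW.
  apply: (@le_lt_trans _ _ (K%:E * (K%:E * K%:E))%E); last first.
    by rewrite -!EFinM ltry.
  (* From the outside in, [C] is [K * K], then [K] times the weight of [z], then the product of the
     weights of [z] and [y]. *)
  apply: (int_le) => [|z Ez]; first exact: mule_ge0.
  split.
    apply: integral_ge0 => y _; apply: integral_ge0 => x _; exact: poweR_ge0.
  rewrite -muleA; apply: (int_le) => [|y Ey].
    by rewrite mule_ge0// weight_ge0.
  split; first by apply: integral_ge0 => x _; exact: poweR_ge0.
  rewrite -muleA; apply: (int_le) => [|x Ex].
    by rewrite mule_ge0 ?weight_ge0.
  by rewrite poweR_ge0 kappa_le.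
Qed.
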